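(* Let $G$ be an $N$-free ordered group of finite width with identity $e$, having at least two canonical levels, and write its canonical chain as $H_1<\cdots<H_r=G$ with $r\ge2$. Define $$K(G):=\{e\}\cup\{x\in\operatorname{inc}(e):\{x\}\text{ is a connected component of }\operatorname{Comp}(G)[\operatorname{inc}(e)]\},$$ $$L(G):=\{g\in I(G)(e): g\parallel x\text{ for every }x\in\operatorname{inc}(e)\}.$$ If $H_1$ has type $\mathbf A$, then $K(G)=H_1$ and $L(G)=\{e\}$. If $H_1$ has type $\mathbf C$, then $K(G)=\{e\}$ and $L(G)=H_1$.
   Context: An ordered group is a group $G$ (identity $e$) equipped with a partial order $\le$ such that $x\le y$ implies $axb\le ayb$ for all $a,b,x,y\in G$. A poset is $N$-free if it has no four distinct elements $a,b,c,d$ whose only strict comparabilities among themselves are $a<b$, $c<b$, $c<d$. Finite width means that antichains have bounded finite size. $x\parallel y$ means $x$ and $y$ are incomparable (in particular $x\ne y$), and $\operatorname{inc}(e):=\{y\in G:y\parallel e\}$. $\operatorname{Comp}(G)$ is the graph on $G$ joining distinct comparable elements; $\operatorname{Comp}(G)[\operatorname{inc}(e)]$ is its induced subgraph on $\operatorname{inc}(e)$. $\operatorname{Inc}(G)$ is the graph on $G$ joining incomparable elements, and $I(G)(e)$ is the connected component of $e$ in $\operatorname{Inc}(G)$. A module of a poset $X$ is a subset $M$ such that for every $x\in X\setminus M$ and $m,m'\in M$: $x\le m\iff x\le m'$ and $m\le x\iff m'\le x$. A nonempty module $M$ is strong if every module is disjoint from $M$, contained in $M$, or contains $M$. $S(x,y)$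 is the least strong module containing $x$ and $y$. The canonical chain is $\mathcal V(G):=\{S(e,g):g\ne e\}$; its members (canonical levels) are convex subgroups forming a chain under inclusion, which is finite here with largest member $G$. With $H_0=\{e\}$, each $H_i/H_{i-1}$ ($H_{i-1}$ is normal in $H_i$), with the quotient order ($\alpha\le\beta$ iff $a\le b$ for some $a\in\alpha$, $b\in\beta$), is totally ordered ($H_i$ has type $\mathbf C$) or equality-ordered, i.e. its order is equality ($H_i$ has type $\mathbf A$). *)

(* Defs.v *)
From HB Require Import structures.
From mathcomp Require Import all_boot all_order.
From mathcomp Require Import boolp classical_sets functions cardinality.

Set Implicit Arguments.
Unset Strict Implicit.
Unset Printing Implicit Defensive.

Local Open Scope classical_set_scope.
Local Open Scope group_scope.
Local Open Scope order_scope.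

HB.mixin Record Group_POrder_isOrderedGroup (d : Order.disp_t) G
    of Group G & Order.POrder d G := {
  le_mul2 : forall a b x y : G, x <= y -> a * x * b <= a * y * b
}.

#[short(type="orderedGroupType")]
HB.structure Definition OrderedGroup (d : Order.disp_t) :=
  {G of Group G & Order.POrder d G & Group_POrder_isOrderedGroup d G}.

Section Graph.
Variables (T : eqType) (e : rel T).

(* The vertices reachable from x inside the subgraph of e induced on A; this is
   a connected component when e is symmetric and x lies in A. *)
Definition induced_component (A : set T) (x : T) : set T :=
  [set y | exists p : seq T,
     [/\ path e x p, last x p = y & [set` x :: p] `<=` A]].

Definition is_component (A C : set T) : Prop :=
  exists2 x, A x & C = induced_component A x.

End Graph.

Section Poset.
Variables (d : Order.disp_t) (T : porderType d).
Implicit Types (x y : T) (A M : set T).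

Definition comp_graph : rel T := [rel x y | (x != y) && (x >=< y)].

Definition inc_graph : rel T := [rel x y | x >< y].

Definition N_free : Prop :=
  ~ exists a b c w : T,
      [/\ uniq [:: a; b; c; w],
          [/\ a < b, c < b & c < w] &
          [/\ a >< c, a >< w & b >< w]].

Definition antichain A : Prop :=
  forall x y, A x -> A y -> x != y -> x >< y.

Definition finite_width : Prop :=
  exists n : nat, forall A, antichain A -> (A #<= `I_n)%card.

Definition is_module M : Prop :=
  forall x m m', ~ M x -> M m -> M m' ->
    (x <= m <-> x <= m') /\ (m <= x <-> m' <= x).

Definition strong_module M : Prop :=
  [/\ M !=set0, is_module M &
      forall N, is_module N -> [\/ N `&` M = set0, N `<=` M | M `<=` N]].

(* [smallest] is an intersection; it is itself a strong module by
   [least_strong_strong] below. *)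
Definition least_strong x y : set T := smallest strong_module [set x; y].

Lemma least_strong_strong x y : strong_module (least_strong x y).
Proof.
split.
- by exists x => M [_ sub]; apply: sub; left.
- move=> z m m' nSz Sm Sm'.
  have /existsNP[M /not_implyP[[sM sub] nMz]] := nSz.
  case: (sM) => _ mM _.
  by apply: mM => //; [apply: Sm | apply: Sm'].
- move=> N mN.
  have [NS0|NS] := pselect (N `&` least_strong x y = set0); first exact: Or31.
  have /set0P[z [Nz Sz]] : N `&` least_strong x y != set0 by apply/eqP.
  have [sub|nsub] := pselect (exists2 M,
      strong_module M /\ [set x; y] `<=` M & M `<=` N).
    case: sub => M MP MN; apply: Or33 => w Sw; exact: MN (Sw M MP).
  apply: Or32 => w Nw M MP; case: (MP) => -[_ _ sM] _.
  case: (sM N mN) => [NM0|NM|MN]; last by case: nsub; exists M.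
    have : (N `&` M) z by split=> //; apply: (Sz M MP).
    by rewrite NM0.
  exact: NM.
Qed.

End Poset.

Section OrderedGroupDefs.
Variables (d : Order.disp_t) (G : orderedGroupType d).
Implicit Types (g x : G) (A B N H : set G).

Definition inc g : set G := [set y | y >< g].

Definition canonical_chain : set (set G) :=
  [set least_strong 1 g | g in [set g | g != 1]].

(* H 1, ..., H r are the canonical levels in increasing order, preceded by the
   trivial subgroup H 0; the values of H beyond r are irrelevant. *)
Definition is_canonical_enumeration (r : nat) (H : nat -> set G) : Prop :=
  [/\ H 0%N = [set 1],
      forall i, (1 <= i < r)%N -> H i `<` H i.+1,
      canonical_chain = [set H i | i in [set i | (1 <= i <= r)%N]] &
      H r = setT].

Definition left_coset N x : set G := [set x * n | n in N].

Definition quotient N H : set (set G) := [set left_coset N x | x in H].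

Definition quotient_le A B : Prop := exists a b, [/\ A a, B b & a <= b].

(* Types of the level H over the preceding one N.  When N is normal and convex
   in H, [quotient_le] is a partial order on [quotient N H], so that only
   totality has to be required for type C. *)
Definition type_C N H : Prop :=
  forall A B, quotient N H A -> quotient N H B ->
    quotient_le A B \/ quotient_le B A.

Definition type_A N H : Prop :=
  forall A B, quotient N H A -> quotient N H B ->
    (quotient_le A B <-> A = B).

Definition K : set G :=
  [set 1] `|` [set x | inc 1 x /\ is_component (@comp_graph d G) (inc 1) [set x]].

Definition L : set G :=
  [set g | induced_component (@inc_graph d G) setT 1 g /\
           forall x, inc 1 x -> g >< x].

End OrderedGroupDefs.

Arguments N_free {d} T.
Arguments finite_width {d} T.
Arguments K {d} G.
Arguments L {d} G.

(* Main.v *)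
Require Import Defs.
From HB Require Import structures.
From mathcomp Require Import all_boot all_order.
From mathcomp Require Import boolp classical_sets functions cardinality.

Set Implicit Arguments.
Unset Strict Implicit.
Unset Printing Implicit Defensive.

(** Inversion and translation turn one-sided inclusions between incomparability
    sets into equalities: if every [x] incomparable to [e] is incomparable to
    [g], then [inc g = inc e]. Hence [M = {g | inc e `<=` inc g}] is a chain and
    a module, and for [x] in [K(G)] different from [e] the pair [{e, x}] is a
    module. A strong module with at least two elements contains every chain
    module that it meets (initial and final segments of a chain module are
    modules), so [H_1] contains [M]; comparing [H_1] with [{e, x}] shows that it
    contains [K(G)]. The reverse inclusions hold because [H_1] is a module. *)

Local Open Scope classical_set_scope.
Local Open Scope group_scope.
Local Open Scope order_scope.

Import Order.TTheory.

(** * Chain modules, strong modules and isolated vertices in a poset *)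

Section PosetModules.
Variables (d : Order.disp_t) (T : porderType d).
Implicit Types (x y z : T) (M S : set T).

Lemma module_comparable M x m m' :
  is_module M -> ~ M x -> M m -> M m' -> (x >=< m) = (x >=< m').
Proof.
move=> mM nMx Mm Mm'; have [[h1 h2] [h3 h4]] := mM x m m' nMx Mm Mm'.
rewrite /Order.comparable; apply/idP/idP => /orP[] h; apply/orP; by auto.
Qed.

(** A point of [M] outside the segment lies above [z], as [M] is a chain, hence above the whole
    segment; points outside [M] see no difference. *)
Lemma initial_segment_module M z :
  is_module M -> {in M &, forall x y, x >=< y} -> M z ->
  is_module [set y | M y /\ y <= z].
Proof.
move=> mM chainM Mz x m m' nDx [Mm mz] [Mm' m'z].
have [Mx|nMx] := pselect (M x); last exact: mM.
have zx : z < x.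
  have /comparable_leP[xz|//] := chainM x z (mem_set Mx) (mem_set Mz).
  by case: nDx.
have lt y : y <= z -> (x <= y) = false /\ y <= x.
  by move=> yz; rewrite lt_geF ?ltW // (le_lt_trans yz zx).
by have [-> ->] := lt m mz; have [-> ->] := lt m' m'z.
Qed.

Lemma final_segment_module M z :
  is_module M -> {in M &, forall x y, x >=< y} -> M z ->
  is_module [set y | M y /\ z <= y].
Proof.
move=> mM chainM Mz x m m' nDx [Mm mz] [Mm' m'z].
have [Mx|nMx] := pselect (M x); last exact: mM.
have xz : x < z.
  have /comparable_leP[zx|//] := chainM z x (mem_set Mz) (mem_set Mx).
  by case: nDx.
have lt y : z <= y -> (y <= x) = false /\ x <= y.
  by move=> yz; rewrite lt_geF ?ltW // (lt_le_trans xz yz).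
by have [-> ->] := lt m mz; have [-> ->] := lt m' m'z.
Qed.

(** Otherwise [S] is properly contained in [M], hence a chain, and a segment of [M] cut at [a] or
    [b] overlaps [S] without containing it, against strength. *)
Lemma strong_module_chain_sub S M a b c :
  strong_module S -> S a -> S b -> a != b ->
  is_module M -> {in M &, forall x y, x >=< y} -> M c -> S c ->
  M `<=` S.
Proof.
move=> [_ mS strS] Sa Sb ab mM chainM Mc Sc.
case: (strS _ mM) => [MS0|//|SM].
  by have : (M `&` S) c by []; rewrite MS0.
move=> z Mz; apply: contrapT => nSz.
have chain x y : M x -> M y -> x >=< y.
  by move=> Mx My; apply: chainM; apply: mem_set.
wlog {ab} ltab : a b Sa Sb / a < b => [hw|].
  have /comparable_ltgtP[|| eab] := chain _ _ (SM _ Sa) (SM _ Sb).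
  - exact: hw.
  - exact: hw.
  - by rewrite eab eqxx in ab.
(* A module containing [z] and exactly one of [a], [b] is in none of the three positions allowed
   relative to [S]. *)
have cross N : is_module N -> N z -> (N a /\ ~ N b) \/ (N b /\ ~ N a) -> False.
  move=> mN Nz ss; case: (strS N mN) => [NS0|NS|SN].
  - case: ss => -[Ny _].
      by have : (N `&` S) a by []; rewrite NS0.
    by have : (N `&` S) b by []; rewrite NS0.
  - exact/nSz/NS.
  - by case: ss => -[_]; apply; apply: SN.
have /comparable_leP[za|az] := chain _ _ Mz (SM _ Sa).
  apply: (cross _ (initial_segment_module mM chainM (SM _ Sa))) => //.
  by left; split; [split=> //; exact: SM | case=> _; rewrite lt_geF].
(* As [z] is outside the module [S], lying above [a] forces it above [b]. *)
have bz : b <= z by have [_ [h _]] := mS z a b nSz Sa Sb; exact/h/ltW.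
apply: (cross _ (final_segment_module mM chainM (SM _ Sb))) => //.
by right; split; [split=> //; exact: SM | case=> _; rewrite lt_geF].
Qed.

Lemma singleton_componentP (A : set T) x :
  is_component (@comp_graph d T) A [set x] <->
  A x /\ forall y, A y -> y >=< x -> y = x.
Proof.
split=> [[x0 Ax0 cx]|[Ax iso]].
  have ex : x0 = x.
    have : induced_component (@comp_graph d T) A x0 x0.
      by exists [::]; split=> // y /=; rewrite inE => /eqP ->.
    by rewrite -cx.
  rewrite {}ex in Ax0 cx; split=> // y Ay yx.
  have [//|nyx] := eqVneq y x.
  have : induced_component (@comp_graph d T) A x y.
    exists [:: y]; split=> //=.
      by rewrite /comp_graph /= eq_sym nyx comparable_sym yx.
    by move=> w /=; rewrite !inE => /orP[] /eqP ->.
  by rewrite -cx.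
exists x => //; rewrite eqEsubset; split=> [y ->|y [[|w p]]] /=.
- by exists [::]; split=> // w /=; rewrite inE => /eqP ->.
- by case.
- move=> [/andP[/andP[xw cxw] _] _ sub].
  have /sub Aw : w \in [:: x, w & p] by rewrite !inE eqxx orbT.
  by move: xw; rewrite (iso w Aw) ?eqxx // comparable_sym.
Qed.

End PosetModules.

(** * Translations, and the modules around the identity of an ordered group *)

Section OrderedGroupTheory.
Variables (d : Order.disp_t) (G : orderedGroupType d).
Implicit Types (a g x y : G).

Lemma lemul2l a x y : (a * x <= a * y) = (x <= y).
Proof.
apply/idP/idP => [h|h].
  by have := le_mul2 a^-1 1 _ _ h; rewrite !mulg1 !mulKg.
by have := le_mul2 a 1 _ _ h; rewrite !mulg1.
Qed.

Lemma lemul2r a x y : (x * a <= y * a) = (x <= y).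
Proof.
apply/idP/idP => [h|h].
  by have := le_mul2 1 a^-1 _ _ h; rewrite !mul1g !mulgK.
by have := le_mul2 1 a _ _ h; rewrite !mul1g.
Qed.

Lemma comparable_mul2l a x y : (a * x >=< a * y) = (x >=< y).
Proof. by rewrite /Order.comparable !lemul2l. Qed.

Lemma comparable_mul2r a x y : (x * a >=< y * a) = (x >=< y).
Proof. by rewrite /Order.comparable !lemul2r. Qed.

Lemma comparable_inv1 x : (x^-1 >=< 1) = (x >=< 1).
Proof. by rewrite -(comparable_mul2l x x^-1) mulgV mulg1 comparable_sym. Qed.

Lemma comparable_ldiv1 x y : (x^-1 * y >=< 1) = (y >=< x).
Proof. by rewrite -(comparable_mul2l x (x^-1 * y)) mulVKg mulg1. Qed.

Lemma comparable_ldiv x y : (y^-1 * x >=< x) = (y >=< 1).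
Proof.
by rewrite -[X in _ >=< X]mul1g comparable_mul2r comparable_inv1.
Qed.

(* [x >< g] says that [x^-1 * g] is incomparable to [1], hence to [g]; cancel
   [g] on the right. *)
Lemma inc_sub_eq g :
  (forall x, inc 1 x -> g >< x) -> forall x, (x >=< g) = (x >=< 1).
Proof.
move=> sub x; apply/idP/idP; apply: contraTT => h.
  by rewrite comparable_sym; apply: sub.
rewrite -(comparable_ldiv g) comparable_sym; apply: sub.
by rewrite /inc /= comparable_ldiv1 comparable_sym.
Qed.

Lemma inc_subD1_eq x :
  inc 1 x -> (forall y, inc 1 y -> y != x -> y >< x) ->
  forall y, y != 1 -> y != x -> (y >=< x) = (y >=< 1).
Proof.
move=> x1 sub y y1 yx; apply/idP/idP; apply: contraTT => h.
  exact: sub.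
rewrite -(comparable_ldiv x); apply: sub.
  by rewrite /inc /= comparable_ldiv1 comparable_sym.
(* The translate [y^-1 * x] equals the excluded point [x] only if [y = 1]. *)
apply: contra_neq y1 => /(congr1 (fun z => y * z)).
by rewrite mulVKg -{1}[x]mul1g => /mulIg.
Qed.

(** The set [M] of the overview; [L G] is its part in the component of [1]. *)
Definition inc_sub_set : set G := [set g | forall x, inc 1 x -> g >< x].

Lemma inc_sub_chain : {in inc_sub_set &, forall x y, x >=< y}.
Proof.
move=> x y /set_mem Mx /set_mem My.
by rewrite (inc_sub_eq My) comparable_sym (inc_sub_eq Mx) comparablexx.
Qed.

Lemma inc_sub_convex x y z :
  inc_sub_set x -> inc_sub_set y -> x <= z -> z <= y -> inc_sub_set z.
Proof.
move=> Mx My xz zy w iw; apply/negP => /orP[zw|wz].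
  by have := Mx w iw; rewrite /Order.comparable (le_trans xz zw).
by have := My w iw; rewrite /Order.comparable (le_trans wz zy) orbT.
Qed.

(** A point is comparable to all members or to none; by convexity, a point outside cannot lie above
    one member and below another. *)
Lemma inc_sub_module : is_module inc_sub_set.
Proof.
move=> z m m' nMz Mm Mm'.
have cmp : (z >=< m) = (z >=< m') by rewrite (inc_sub_eq Mm) (inc_sub_eq Mm').
wlog suff hw : m m' Mm Mm' cmp / (z <= m -> z <= m') /\ (m <= z -> m' <= z).
  have [h1 h2] := hw m m' Mm Mm' cmp.
  by have [h3 h4] := hw m' m Mm' Mm (esym cmp).
split=> h.
  have : z >=< m' by rewrite -cmp /Order.comparable h.
  by case/orP=> // h'; case: nMz; exact: inc_sub_convex h' h.
have : z >=< m' by rewrite -cmp /Order.comparable h orbT.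
by case/orP=> // h'; case: nMz; exact: inc_sub_convex h h'.
Qed.

(** An outside point is comparable to both [1] and [x] or to neither; lying between them would make
    them comparable. *)
Lemma K_pair_module x : inc 1 x -> (forall y, inc 1 y -> y >=< x -> y = x) ->
  is_module [set 1; x].
Proof.
move=> x1 iso y.
have cmp : ~ [set 1; x] y -> (y >=< x) = (y >=< 1).
  move=> nMy; apply: inc_subD1_eq => //.
  - by move=> z z1; apply: contra_neqN; exact: iso.
  - by apply/eqP => y1; apply: nMy; left.
  - by apply/eqP => yx; apply: nMy; right.
suff h m m' : ~ [set 1; x] y -> (y >=< m) = (y >=< m') -> ~~ (m >=< m') ->
    (y <= m -> y <= m') /\ (m <= y -> m' <= y).
  have nx1 : ~~ (1 >=< x) by rewrite comparable_sym.
  move=> m m' nMy; have e := cmp nMy.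
  have [h1 h2] := h 1 x nMy (esym e) nx1; have [h3 h4] := h x 1 nMy e x1.
  by move=> [] -> [] ->.
move=> nMy e nmm; split=> h.
  have : y >=< m' by rewrite -e /Order.comparable h.
  case/orP=> // h'; case/negP: nmm.
  by rewrite /Order.comparable (le_trans h' h) orbT.
have : y >=< m' by rewrite -e /Order.comparable h orbT.
case/orP=> // h'; case/negP: nmm.
by rewrite /Order.comparable (le_trans h h').
Qed.

Lemma left_coset1 x : left_coset [set 1] x = [set x].
Proof.
by rewrite /left_coset image_set1 mulg1.
Qed.

Lemma quotient_le1 x y : quotient_le [set x] [set y] <-> x <= y.
Proof.
by split=> [[a [b [-> ->]]]|xy] //; exists x, y.
Qed.

(** Cosets of the trivial subgroup are singletons, so the quotient order is the order of [S]
    itself. *)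
Lemma type_C1 (S : set G) x y : type_C [set 1] S -> S x -> S y -> x >=< y.
Proof.
move=> tC Sx Sy; have q z : S z -> quotient [set 1] S [set z].
  by move=> Sz; exists z => //; exact: left_coset1.
by case: (tC _ _ (q x Sx) (q y Sy)) => /quotient_le1 h;
  rewrite /Order.comparable h ?orbT.
Qed.

Lemma type_A1 (S : set G) x y :
  type_A [set 1] S -> S x -> S y -> x >=< y -> x = y.
Proof.
move=> tA Sx Sy; have q z : S z -> quotient [set 1] S [set z].
  by move=> Sz; exists z => //; exact: left_coset1.
have inj (u v : G) : [set u] = [set v] -> u = v.
  by move=> uv; have : [set u] u by []; rewrite uv.
by case/orP => h; [apply: inj | apply/esym/inj]; apply/tA;
  by [exact: q | apply/quotient_le1].
Qed.

Section StrongModule.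
Variables (S : set G) (g : G).
Hypotheses (strS : strong_module S) (S1 : S 1) (Sg : S g) (g1 : g != 1).

Lemma inc_sub_strong : inc_sub_set `<=` S.
Proof.
have M1 : inc_sub_set 1 by move=> x; rewrite /inc /= comparable_sym.
exact: strong_module_chain_sub g1 inc_sub_module inc_sub_chain M1 S1.
Qed.

(** If nothing were incomparable to [1], then [inc_sub_set] would be all of [G], and so would
    [S]. *)
Lemma inc1_neq0 z : ~ S z -> exists x : G, inc 1 x.
Proof.
move=> nSz; apply: contrapT => ninc; apply: nSz; apply: inc_sub_strong.
by move=> x ix; case: ninc; exists x.
Qed.

Lemma K_sub_strong : K G `<=` S.
Proof.
move=> x [->//|[ix /singleton_componentP[_ iso]]].
have [_ _ /(_ _ (K_pair_module ix iso))[NS0|NS|SN]] := strS.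
- have : ([set 1; x] `&` S) 1 by split=> //; left.
  by rewrite NS0.
- by apply: NS; right.
(* If [S] lies inside the pair, its element [g] other than [1] must be [x]. *)
- by case: (SN _ Sg) => [/eqP|<-//]; rewrite (negPf g1).
Qed.

End StrongModule.

End OrderedGroupTheory.

Theorem proposition8p3 (d : Order.disp_t) (G : orderedGroupType d)
    (r : nat) (H : nat -> set G) :
  N_free G -> finite_width G ->
  (2 <= r)%N -> is_canonical_enumeration r H ->
  (type_A (H 0%N) (H 1%N) -> K G = H 1%N /\ L G = [set 1]) /\
  (type_C (H 0%N) (H 1%N) -> K G = [set 1] /\ L G = H 1%N).
Proof.
move=> _ _ r2 [H0 Hlt Hchain _]; rewrite {}H0.
have [z nHz] : exists z, ~ H 1%N z.
  by have [_ /nonsubset[z [_ nHz]]] := Hlt 1%N r2; exists z.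
have [g g1 Hg] : canonical_chain (H 1%N).
  by rewrite Hchain; exists 1%N => //=; rewrite (leq_trans _ r2).
have strH : strong_module (H 1%N) by rewrite -Hg; exact: least_strong_strong.
have H1 : H 1%N 1 by rewrite -Hg => M [_]; apply; left.
have {}Hg : H 1%N g by rewrite -Hg => M [_]; apply; right.
have [x0 ix0] := inc1_neq0 strH H1 Hg g1 nHz.
have KH := K_sub_strong strH H1 Hg g1.
have LH : L G `<=` H 1%N by move=> x [_ Lx]; exact: (inc_sub_strong strH H1 Hg g1).
have [_ mH _] := strH.
(* Outside the module [H 1], comparability with [x] would give comparability with [1]. *)
have incmod y x : inc 1 y -> H 1%N x -> y >=< x -> H 1%N y.
  move=> iy Hx yx; apply: contrapT => nHy.
  by move: iy; rewrite /inc /= (module_comparable mH nHy H1 Hx) yx.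
have K1 : K G 1 by left.
split=> [tA|tC]; split; rewrite eqEsubset; split=> // x.
- move=> Hx; have [->|x1] := eqVneq x 1; first by [].
  have ix : inc 1 x by apply: contra_neqN x1; exact: type_A1 tA Hx H1.
  right; split=> //; apply/singleton_componentP; split=> // y iy yx.
  exact: type_A1 tA (incmod y x iy Hx yx) Hx yx.
- move=> Lx; have Hx := LH x Lx; apply: (type_A1 tA Hx H1).
  have [_ sub] := Lx.
  (* If [x] were in [inc 1], membership in [L G] would make it incomparable to itself. *)
  by rewrite -[_ >=< _]negbK; apply/negP => /sub; rewrite comparablexx.
- move=> ->; split; last by move=> y; rewrite /inc /= comparable_sym.
  by exists [::].
- move=> Kx; case: (Kx) => [//|[ix _]].
  by move: ix; rewrite /inc /= (type_C1 tC (KH x Kx) H1).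
- by move=> ->.
- move=> Hx; have sub y : inc 1 y -> x >< y.
    move=> iy; apply/negP => xy.
    have Hy : H 1%N y by apply: (incmod y x) => //; rewrite comparable_sym.
    by move: iy; rewrite /inc /= (type_C1 tC Hy H1).
  (* Any [x0] incomparable to [1] is also incomparable to [x], so it links them in [inc_graph]. *)
  split=> //; exists [:: x0; x]; split=> //=.
  by rewrite /inc_graph /= andbT [1 >=< _]comparable_sym ix0 comparable_sym sub.
Qed.
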